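(* Let $G$ be a Lie group, $H\subset G$ a closed subgroup, $X:=G/H$, let $(\rho,V)$ be a finite dimensional real representation of $G$, $v_0\in V^H$ an $H$-fixed vector, and $\mu$ a relatively $G$-invariant measure on $X$. Let $\Theta\subset V^\vee\times\Omega_0(G,H)$ be the associated parameter set and $\mathcal{P}=\{p_\theta\}_{\theta\in\Theta}$ the associated family of probability measures on $X$ (all as defined in the context). For $\xi\in V^\vee$ define $f_\xi:G\to\mathbb{R}$ by $f_\xi(g):=\langle \xi, gv_0-v_0\rangle$ for $g\in G$. Then the following three conditions are equivalent: (i) The correspondence $\Theta\ni\theta\mapsto p_\theta\in\mathcal{P}$ is injective. (ii) There does not exist $\xi\in V^\vee\setminus\{0\}$ such that $f_\xi\in\log\Omega_0(G,H)$. (iii) There does not exist a triple $(\xi,\chi,c)\in (V^\vee\setminus\{0\})\times\Omega_0(G,H)\times\mathbb{R}$ satisfying $\langle\xi,gv_0\rangle=\log\chi(g)+c$ for any $g\in G$.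
   Context: A (finite dimensional real) representation of a Lie group $G$ is a finite dimensional real vector space $V$ with a Lie group homomorphism $\rho:G\to GL(V)$; write $gv:=\rho(g)v$. $V^\vee$ is the dual space, with pairing $\langle\cdot,\cdot\rangle$. $V^H:=\{v\in V: hv=v \text{ for all } h\in H\}$. $\Omega_0(G,H):=\{\chi:G\to\mathbb{R}_{>0} : \chi \text{ is a continuous group homomorphism},\ \chi|_H=1\}$ and $\log\Omega_0(G,H):=\{\log\chi:G\to\mathbb{R} : \chi\in\Omega_0(G,H)\}$. A relatively $G$-invariant measure on $X=G/H$ is a nonzero Radon measure $\mu$ such that each $g\in G$ translates $\mu$ to a positive multiple $c(g)\mu$, with $c:G\to\mathbb{R}_{>0}$ a continuous homomorphism. For $\theta=(\xi,\chi)\in V^\vee\times\Omega_0(G,H)$ define the measure $\tilde p_\theta$ on $X$ by $d\tilde p_\theta(x):=\exp(-\langle\xi,xv_0\rangle)\,\chi(x)\,d\mu(x)$ ($x\in X$); here $xv_0:=gv_0$ and $\chi(x):=\chi(g)$ for $x=gH$, which are well defined since $v_0$ is $H$-fixed and $\chi|_H=1$. Put $$\Theta:=\Big\{\theta\in V^\vee\times\Omega_0(G,H): \int_X d\tilde p_\theta<\infty\Big\},\quad \varphi(\theta):=\log\int_X d\tilde p_\theta,\quad dp_\theta:=e^{-\varphi(\theta)}d\tilde p_\theta\quad(\theta\in\Theta),$$ and $\mathcal{P}:=\{p_\theta\}_{\theta\in\Theta}$.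
   Formalization: The parameter set Θ is assumed nonempty; without this the equivalence fails, e.g. for G = R, H trivial, μ Lebesgue, V = R the trivial representation and v_0 = 1, where Θ is empty and (i) holds vacuously while (ii) and (iii) fail. *)

(* Defs.v *)
From HB Require Import structures.
From mathcomp Require Import all_boot all_order all_algebra.
From mathcomp Require Import all_classical all_reals all_analysis.
Import Order.TTheory GRing.Theory Num.Theory.
Import numFieldNormedType.Exports.

Set Implicit Arguments.
Unset Strict Implicit.
Unset Printing Implicit Defensive.

Local Open Scope classical_set_scope.
Local Open Scope ring_scope.
Local Open Scope quotient_scope.

(* C^oo on an open set U: every iterated directional derivative of f is Frechet
   differentiable (hence continuous) at every point of U. *)
Definition smooth_on (R : realType) (E F : normedModType R)
    (U : set E) (f : E -> F) : Prop :=
  forall (vs : seq E) (x : E), U x ->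
    differentiable (foldr (fun v g => 'D_v g) f vs) x.

(* A homeomorphism from an open subset of T onto an open subset of R^n; only the
   restrictions of chart_fun and chart_inv to these sets matter. *)
Record chart (R : realType) (n : nat) (T : topologicalType) := Chart {
  chart_dom : set T;
  chart_fun : T -> 'rV[R]_n;
  chart_inv : 'rV[R]_n -> T;
  chart_dom_open : open chart_dom;
  chart_cod_open : open (chart_fun @` chart_dom);
  chart_funK : forall x, chart_dom x -> chart_inv (chart_fun x) = x;
  chart_fun_continuous : {within chart_dom, continuous chart_fun};
  chart_inv_continuous : {within chart_fun @` chart_dom, continuous chart_inv}
}.

Definition chart_cod (R : realType) (n : nat) (T : topologicalType)
  (a : chart R n T) : set 'rV[R]_n := chart_fun a @` chart_dom a.

(* The smooth structure is given by an atlas, which need not be maximal. *)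
HB.mixin Record isLieGroup (R : realType) (n : nat) G
    & Group G & Topological G := {
  lie_atlas : set (chart R n G);
  lie_hausdorff : hausdorff_space G;
  lie_second_countable : @second_countable G;
  lie_atlas_cover : forall x : G, exists2 a, lie_atlas a & chart_dom a x;
  lie_atlas_compat : forall a b, lie_atlas a -> lie_atlas b ->
    smooth_on (chart_fun a @` (chart_dom a `&` chart_dom b))
      (chart_fun b \o chart_inv a);
  lie_mulg_continuous : continuous (fun z : G * G => (z.1 * z.2)%g);
  lie_mulg_smooth : forall a b c, lie_atlas a -> lie_atlas b -> lie_atlas c ->
    smooth_on
      [set z : 'rV[R]_n * 'rV[R]_n | [/\ chart_cod a z.1, chart_cod b z.2 &
         chart_dom c (chart_inv a z.1 * chart_inv b z.2)%g]]
      (fun z => chart_fun c (chart_inv a z.1 * chart_inv b z.2)%g);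
  lie_invg_continuous : continuous (fun x : G => x^-1%g);
  lie_invg_smooth : forall a b, lie_atlas a -> lie_atlas b ->
    smooth_on
      [set z | chart_cod a z /\ chart_dom b (chart_inv a z)^-1%g]
      (fun z => chart_fun b (chart_inv a z)^-1%g)
}.

#[short(type="lieGroupType")]
HB.structure Definition LieGroup (R : realType) (n : nat) :=
  {G of isLieGroup R n G & Group G & Topological G}.

Record closed_subgroup (R : realType) (n : nat) (G : lieGroupType R n) :=
  ClosedSubgroup {
  subgroup_set : set G;
  subgroup1 : subgroup_set 1%g;
  subgroupM : forall x y,
    subgroup_set x -> subgroup_set y -> subgroup_set (x * y)%g;
  subgroupV : forall x, subgroup_set x -> subgroup_set x^-1%g;
  subgroup_closed : closed subgroup_set
}.

(* A Lie group homomorphism into GL(V). Smoothness is read in the global chart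
   of End(V) given by matrices in a basis of V; invertibility of rho g follows
   from the first two axioms. *)
Record representation (R : realType) (n : nat) (G : lieGroupType R n)
    (V : vectType R) := Representation {
  rep_fun :> G -> 'End(V);
  rep1 : rep_fun 1%g = \1%VF;
  repM : forall x y, rep_fun (x * y)%g = (rep_fun x \o rep_fun y)%VF;
  rep_smooth : forall a : chart R n G, lie_atlas a ->
    smooth_on (chart_cod a) (fun z =>
      passmx.mxof (vbasis {:V}) (vbasis {:V}) (rep_fun (chart_inv a z)))
}.

Section HomogeneousSpace.
Context (R : realType) (n : nat) (G : lieGroupType R n).
Variable H : closed_subgroup G.

Definition coset_rel : rel G := fun x y => `[< subgroup_set H (x^-1 * y)%g >].

Lemma coset_rel_refl : reflexive coset_rel.
Proof. by move=> x; apply/asboolP; rewrite mulVg; exact: subgroup1. Qed.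

Lemma coset_rel_sym : symmetric coset_rel.
Proof.
suff S x y : coset_rel x y -> coset_rel y x by move=> x y; apply/idP/idP => /S.
by move=> /asboolP/subgroupV Hxy; apply/asboolP; rewrite invgM invgK in Hxy.
Qed.

Lemma coset_rel_trans : transitive coset_rel.
Proof.
move=> y x z /asboolP Hxy /asboolP Hyz; apply/asboolP.
by have := subgroupM Hxy Hyz; rewrite mulgA -(mulgA x^-1%g) mulgV mulg1.
Qed.

Canonical coset_equiv :=
  EquivRel coset_rel coset_rel_refl coset_rel_sym coset_rel_trans.

Definition coset_space : Type := quotient_topology {eq_quot coset_equiv}.

HB.instance Definition _ := Topological.on coset_space.
HB.instance Definition _ := Quotient.on coset_space.
HB.instance Definition _ := isPointed.Build coset_space (\pi_coset_space 1%g).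

Definition coset_act (g : G) (x : coset_space) : coset_space :=
  \pi_coset_space (g * repr x)%g.

Definition borel_coset_space := g_sigma_algebraType (@open coset_space).
HB.instance Definition _ := Measurable.on borel_coset_space.

Definition radon (mu : {measure set borel_coset_space -> \bar R}) : Prop :=
  [/\ forall K : set coset_space, compact K -> (mu K < +oo)%E,
      forall A : set borel_coset_space, measurable A ->
        mu A = ereal_inf [set mu U | U in
                 [set U : set coset_space | open U /\ A `<=` U]] &
      forall U : set coset_space, open U ->
        mu U = ereal_sup [set mu K | K in
                 [set K : set coset_space | compact K /\ K `<=` U]]].

Definition relatively_invariant
    (mu : {measure set borel_coset_space -> \bar R}) : Prop :=
  [/\ mu setT != 0%E, radon mu &
      exists c : G -> R,
        [/\ forall g, 0 < c g, continuous c,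
            forall g h, c (g * h)%g = c g * c h &
            forall g (A : set borel_coset_space), measurable A ->
              mu (coset_act g @^-1` A) = ((c g)%:E * mu A)%E]].

Definition Omega0 : set (G -> R) :=
  [set chi : G -> R |
    [/\ forall g, 0 < chi g, continuous chi,
        forall g h, chi (g * h)%g = chi g * chi h &
        forall h, subgroup_set H h -> chi h = 1]].

Definition log_Omega0 : set (G -> R) := [set @ln R \o chi | chi in Omega0].

Section Family.
Context (V : vectType R).
Variable rho : representation G V.

Definition rep_fixed : set V :=
  [set v | forall h, subgroup_set H h -> rho h v = v].

Variables (v0 : V) (mu : {measure set borel_coset_space -> \bar R}).

(* The values at x = gH of g |-> g v0 and of chi are computed at the chosen
   representative of x; for v0 in rep_fixed and chi in Omega0 they do not depend
   on that choice. *)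
Definition density (theta : 'Hom(V, R^o) * (G -> R)) (x : coset_space) : R :=
  expR (- theta.1 (rho (repr x) v0)) * theta.2 (repr x).

Definition p_tilde (theta : 'Hom(V, R^o) * (G -> R))
    (A : set borel_coset_space) : \bar R :=
  (\int[mu]_(x in A) (density theta x)%:E)%E.

Definition Theta : set ('Hom(V, R^o) * (G -> R)) :=
  [set theta | Omega0 theta.2 /\ (p_tilde theta setT < +oo)%E].

Definition phi (theta : 'Hom(V, R^o) * (G -> R)) : R :=
  ln (fine (p_tilde theta setT)).

Definition p_theta (theta : 'Hom(V, R^o) * (G -> R))
    (A : set borel_coset_space) : \bar R :=
  ((expR (- phi theta))%:E * p_tilde theta A)%E.

(* Two members of the family are equal when they agree on Borel sets. *)
Definition p_theta_injective : Prop :=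
  forall theta theta', Theta theta -> Theta theta' ->
    (forall A : set borel_coset_space, measurable A ->
       p_theta theta A = p_theta theta' A) ->
    theta = theta'.

Definition f_xi (xi : 'Hom(V, R^o)) (g : G) : R := xi (rho g v0 - v0).

End Family.
End HomogeneousSpace.

(* Main.v *)
Require Import Defs.
From HB Require Import structures.
From mathcomp Require Import all_boot all_order all_algebra.
From mathcomp Require Import all_classical all_reals all_analysis.
From mathcomp Require Import measurable_realfun ring lra.
Import Order.TTheory GRing.Theory Num.Theory.
Import numFieldNormedType.Exports.
Set Implicit Arguments.
Unset Strict Implicit.
Local Open Scope classical_set_scope.
Local Open Scope ring_scope.

(** A linear form [xi] with [xi (g v0) = ln (chi g) + c] is exactly an obstruction
to identifying the parameter: replacing [(xi0, chi0)] by
[(xi0 + xi, chi0 * chi)] multiplies the density by the constant [exp (- c)],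
and normalization removes constants ([p_theta_shift]).  Since the parameter set
is not empty, such a [xi <> 0] yields two distinct parameters with the same
measure.

Conversely, suppose that two parameters give the same measure.  Their normalized
densities agree almost everywhere for [mu].  They are continuous, because the
matrix coefficients of [rho] are ([rep_coef_continuous]), so the set where they
differ is open; and a relatively invariant measure charges every nonempty open
set of [G/H] ([relatively_invariant_open_support]), because otherwise the
translates of a null open set, countably many of which cover [G/H] since [G] is
second countable, would make [mu] vanish.  Hence the densities agree everywhere
([p_theta_eq_inv]).  Taking logarithms, the difference of the two linear forms
is [ln chi] plus a constant along the orbit of [v0], so it vanishes if there is
no obstruction, and the two characters are then proportional, hence equal since
both are [1] at the identity ([theta_eq_of_proportional]).

The two ways of stating the obstruction differ only by the value of the
constant, which evaluation at the identity forces to be [xi v0]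
([log_Omega0_f_xiP]). *)

(** * Measure-theoretic preliminaries *)

(** Lindelof argument: the members of a countable basis whose image is negligible
already cover [T].  The image of such a member need not be measurable, hence the
use of [negligible] rather than of measure zero. *)
Lemma negligible_range_of_local d (X : measurableType d) (R : realFieldType)
    (mu : {measure set X -> \bar R}) (T : topologicalType) (p : T -> X) :
  @second_countable T ->
  (forall t : T, exists2 W, nbhs t W & mu.-negligible (p @` W)) ->
  mu.-negligible (range p).
Proof.
move=> [B /pfcard_geP[B0|[e]] [_ Bbase]] locN.
  suff -> : range p = set0 by exact: negligible_set0.
  rewrite -subset0 => _ [t _ <-].
  have [W tW _] := locN t; have [b [+ _] _] := Bbase t W tW.
  by rewrite B0.
(* Members of the basis with a non-negligible image are discarded. *)
pose F k := if pselect (mu.-negligible (p @` e k)) then p @` e k else set0.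
suff sF : range p `<=` \bigcup_k F k.
  apply: negligibleS sF _.
  apply: negligible_bigcup => k; rewrite /F; case: pselect => ?//.
  exact: negligible_set0.
move=> _ [t _ <-]; have [W tW nW] := locN t.
have [b [Bb bt] bW] := Bbase t W tW.
have [k _ ekb] := 'surj_e Bb.
exists k => //; rewrite /F ekb; case: pselect => [nb|[]]; first by exists t.
by apply: negligibleS nW; exact: image_subset.
Qed.

(** Invariance of a normalized mass under scaling, with [I] the total mass and [J]
the mass of a part.  It survives the degenerate case [I = 0], where [ln] takes
a default value, because then [J = 0] as well. *)
Lemma normalization_scale (R : realType) (k : R) (I J : \bar R) :
  0 < k -> I \is a fin_num -> (0 <= J)%E -> (J <= I)%E ->
  ((expR (- ln (fine (k%:E * I))))%:E * (k%:E * J) =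
   (expR (- ln (fine I)))%:E * J)%E.
Proof.
case: I J => [a| |] [b| |]//= k0 _; rewrite !lee_fin => b0 ba.
rewrite -!EFinM; congr EFin.
have [->|b_neq0] := eqVneq b 0; first by rewrite !mulr0.
have a0 : 0 < a by rewrite (lt_le_trans _ ba)// lt_neqAle eq_sym b_neq0.
rewrite lnM ?posrE// opprD expRD [expR (- ln k)]expRN lnK ?posrE//.
by rewrite mulrACA mulVf ?mul1r ?gt_eqF.
Qed.

(** * The homogeneous space and its relatively invariant measures *)

Section CosetSpace.
Context (R : realType) (n : nat) (G : lieGroupType R n).
Variable H : closed_subgroup G.
Local Notation X := (coset_space H).
Local Open Scope quotient_scope.

(** Functions on [G/H] are computed at a chosen representative; this controls how
far it is from a given one. *)
Lemma repr_coset (g : G) :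
  exists2 h, subgroup_set H h & repr (\pi_X g) = (g * h)%g.
Proof.
exists (g^-1 * repr (\pi_X g))%g; last by rewrite mulgA mulgV mul1g.
have /eqquotP/asboolP // : \pi_X g = \pi_X (repr (\pi_X g)) by rewrite reprK.
Qed.

Lemma coset_actE (g k : G) : coset_act g (\pi_X k) = \pi_X (g * k)%g.
Proof.
have [h Hh kh] := repr_coset k; rewrite /coset_act kh; apply/esym/eqquotP.
by apply/asboolP; rewrite (mulgA g k) mulKg.
Qed.

Lemma mulgl_continuous (g : G) : continuous (fun k : G => (g * k)%g).
Proof.
move=> k; apply: (@continuous_comp _ _ _ (fun k => (g, k))
  (fun z : G * G => (z.1 * z.2)%g)); last exact: lie_mulg_continuous.
by apply: cvg_pair; [exact: cvg_cst|exact: cvg_id].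
Qed.

Lemma coset_act_continuous (g : G) : continuous (@coset_act _ _ _ H g).
Proof.
apply/quotient_continuous.
rewrite (_ : _ \o _ = \pi_X \o (fun k : G => g * k)%g); last first.
  by apply/funext => k; exact: coset_actE.
move=> k; apply: continuous_comp; first exact: mulgl_continuous.
exact: pi_continuous.
Qed.

Lemma open_measurable_coset (U : set X) :
  open U -> measurable (U : set (borel_coset_space H)).
Proof. exact: sub_sigma_algebra. Qed.

Lemma continuous_measurable_coset (f : X -> R) :
  continuous f -> measurable_fun [set: borel_coset_space H] f.
Proof.
move=> /continuousP cf.
refine (measurability (RGenOpens.G (R := R)) (RGenOpens.measurableE R) _).
move=> _ [_ [a [b ->] <-]]; rewrite setTI; apply: open_measurable_coset.
exact/cf/interval_open.
Qed.

(** A null open set containing [x0] has a null open translate around any point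
of [G/H], so the whole of [G/H] would be null. *)
Lemma relatively_invariant_open_support
    (mu : {measure set (borel_coset_space H) -> \bar R}) (U : set X) :
  relatively_invariant mu -> open U -> mu U = 0%E -> U = set0.
Proof.
move=> [muT _ [c [_ _ _ muc]]] oU U0; rewrite -subset0 => x0 Ux0.
move/eqP: muT; apply; apply/negligibleP => //.
have -> : [set: borel_coset_space H] = range (\pi_X : G -> borel_coset_space H).
  by apply/seteqP; split=> // x _; exists (repr x) => //; exact: reprK.
apply: negligible_range_of_local; first exact: lie_second_countable.
(* Translation by [a] sends [gH] to [x0]. *)
move=> g; pose a := (repr x0 * g^-1)%g.
have oaU : open (coset_act a @^-1` U).
  by move/continuousP: (@coset_act_continuous a); exact.
exists (\pi_X @^-1` (coset_act a @^-1` U)).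
  apply: pi_continuous; apply: open_nbhs_nbhs; split => //.
  by rewrite /= coset_actE /a -mulgA mulVg mulg1 reprK.
apply: negligibleS; first exact: image_preimage_subset.
apply/negligibleP; first exact: open_measurable_coset.
have := muc a U (open_measurable_coset oU); rewrite U0 mule0; exact: id.
Qed.

(** * Continuity of matrix coefficients *)

Lemma linear_matrix_continuous p q (L : {linear 'M[R]_(p, q) -> R^o}) :
  continuous (L : 'M[R]_(p, q) -> R).
Proof.
have -> : (L : _ -> R) = fun M => \sum_i \sum_j M i j * L (delta_mx i j).
  apply/funext => M; rewrite {1}[M]matrix_sum_delta linear_sum.
  by apply: eq_bigr => i _; rewrite linear_sum; apply: eq_bigr => j _; rewrite linearZ.
apply: continuous_big => [|i _]; first exact: add_continuous.
apply: continuous_big => [|j _ M]; first exact: add_continuous.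
apply: (@cvgMr_tmp _ _ (nbhs M)); exact: coord_continuous.
Qed.

Section Coefficient.
Context (V : vectType R) (rho : representation G V).

(** Around [g], the coefficient is a linear function of the matrix of [rho] read in
a chart, and that matrix is differentiable, hence continuous, in the chart. *)
Lemma rep_coef_continuous (xi : 'Hom(V, R^o)) (v : V) :
  continuous (fun g : G => xi (rho g v) : R).
Proof.
move=> g; have [a Aa ag] := lie_atlas_cover g.
pose e := vbasis {:V}.
pose L (M : 'M[R]_(_, _)) : R^o := xi (passmx.vecof e (passmx.rVof e v *m M)).
have linL : linear L.
  by move=> k M N; rewrite /L mulmxDr -scalemxAr passmx.vecof_linear linearP.
pose lL := GRing.isLinear.Build _ _ _ _ L linL.
pose L' : {linear _ -> _} := HB.pack L lL.
pose M z := passmx.mxof e e (rho (chart_inv a z)).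
have cM : {for chart_fun a g, continuous M}.
  apply: differentiable_continuous.
  (* The empty list of directions: [rho] itself, without differentiation. *)
  by apply: (rep_smooth rho Aa [::]); exists g.
have cf : {in chart_dom a, continuous (chart_fun a)}.
  rewrite -continuous_open_subspace; last exact: chart_dom_open.
  exact: chart_fun_continuous.
have LE k : chart_dom a k -> xi (rho k v) = L (M (chart_fun a k)).
  move=> ak; rewrite /L /M chart_funK//.
  by rewrite -passmx.rVof_app ?vbasisP// passmx.rVofK ?vbasisP.
rewrite /continuous_at LE//.
apply: (@cvg_trans _ (L (M (chart_fun a k)) @[k --> g])).
  apply: near_eq_cvg; near=> k; rewrite LE//; near: k.
  by apply: open_nbhs_nbhs; split => //; exact: chart_dom_open.
apply: (@continuous_comp _ _ _ (M \o chart_fun a) L).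
  by apply: continuous_comp => //; apply: cf; rewrite inE.
exact: (@linear_matrix_continuous _ _ L').
Unshelve. all: by end_near. Qed.

End Coefficient.

(** * Continuous densities and characters *)

(** Equality of the integrals gives equality almost everywhere; the open set where
[f] and [g] differ is then null, hence empty. *)
Lemma continuous_eq_of_integral_eq
    (mu : {measure set (borel_coset_space H) -> \bar R}) (f g : X -> R) :
  relatively_invariant mu -> continuous f -> continuous g ->
  mu.-integrable setT (fun x : borel_coset_space H => (f x)%:E) ->
  (forall A : set (borel_coset_space H), measurable A ->
     (\int[mu]_(x in A) (f x)%:E = \int[mu]_(x in A) (g x)%:E)%E) ->
  f = g.
Proof.
move=> muinv cf cg If fgA.
have mg : measurable_fun [set: borel_coset_space H]
    (fun x : borel_coset_space H => (g x)%:E).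
  by apply/measurable_EFinP; exact: continuous_measurable_coset.
have fg_ae : ae_eq mu setT (fun x : borel_coset_space H => (f x)%:E)
    (fun x : borel_coset_space H => (g x)%:E).
  by apply: integral_ae_eq => // A _; exact: fgA.
pose U : set X := (fun x => f x - g x) @^-1` [set y | y != 0].
have oU : open U.
  have /continuousP : continuous (fun x => f x - g x).
    by move=> x; apply: (@cvgB _ _ _ (nbhs x)); [exact: cf|exact: cg].
  by apply; exact: open_neq.
have U0 : U = set0.
  apply: (relatively_invariant_open_support muinv oU).
  apply/negligibleP; first exact: open_measurable_coset.
  apply: negligibleS fg_ae => x /eqP fgx /= /(_ I) [fgxE].
  by apply: fgx; rewrite fgxE subrr.
apply/funext => x; apply/eqP; rewrite -subr_eq0; apply/negPn/negP => fgx.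
by have : U x by []; rewrite U0.
Qed.

Lemma Omega0M (chi chi' : G -> R) :
  Omega0 H chi -> Omega0 H chi' -> Omega0 H (fun g => chi g * chi' g).
Proof.
move=> [chi0 cchi chiM chiH] [chi0' cchi' chiM' chiH']; split.
- by move=> g; exact: mulr_gt0.
- by move=> g; apply: cvgM; [exact: cchi|exact: cchi'].
- by move=> g h; rewrite chiM chiM' mulrACA.
- by move=> h Hh; rewrite chiH// chiH'// mulr1.
Qed.

Lemma Omega0V (chi : G -> R) : Omega0 H chi -> Omega0 H (fun g => (chi g)^-1).
Proof.
move=> [chi0 cchi chiM chiH]; split.
- by move=> g; rewrite invr_gt0.
- by move=> g; apply: cvgV; [rewrite gt_eqF|exact: cchi].
- by move=> g h; rewrite chiM invfM.
- by move=> h Hh; rewrite chiH// invr1.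
Qed.

Lemma Omega0_1 (chi : G -> R) : Omega0 H chi -> chi 1%g = 1.
Proof. by move=> [_ _ _]; apply; exact: subgroup1. Qed.

(** * The exponential family *)

Section Family.
Context (V : vectType R) (rho : representation G V) (v0 : V).
Hypothesis hv0 : rep_fixed H rho v0.

(** At the identity [chi] is [1], so the constant can only be [xi v0]. *)
Lemma log_Omega0_f_xiP (xi : 'Hom(V, R^o)) :
  log_Omega0 H (f_xi rho v0 xi) <->
  exists (chi : G -> R) (c : R), Omega0 H chi /\
    forall g, xi (rho g v0) = ln (chi g) + c.
Proof.
split=> [[chi Ochi chiE]|[chi [c [Ochi xiE]]]].
  exists chi, (xi v0); split => // g.
  have /(congr1 (fun f => f g)) := chiE.
  by rewrite /f_xi/= linearB/= => ->; rewrite subrK.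
exists chi => //; apply/funext => g.
have := xiE 1%g; rewrite rep1 id_lfunE Omega0_1// ln1 add0r => xiv0.
by rewrite /f_xi linearB/= xiE xiv0 addrK.
Qed.

Section Density.
Variable theta : 'Hom(V, R^o) * (G -> R).
Hypothesis Otheta : Omega0 H theta.2.

(** This is where the [H]-invariance of [v0] and of the character enters. *)
Lemma densityE (g : G) :
  density rho v0 theta (\pi_X g) = expR (- theta.1 (rho g v0)) * theta.2 g.
Proof.
have [_ _ chiM chiH] := Otheta.
have [h Hh gh] := repr_coset g.
by rewrite /density gh repM comp_lfunE (hv0 Hh) chiM (chiH h Hh) mulr1.
Qed.

Lemma density_gt0 (x : X) : 0 < density rho v0 theta x.
Proof. by have [chi0 _ _ _] := Otheta; rewrite mulr_gt0// expR_gt0. Qed.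

Lemma density_continuous : continuous (density rho v0 theta : X -> R).
Proof.
apply/quotient_continuous.
rewrite (_ : _ \o _ = fun g => expR (- theta.1 (rho g v0)) * theta.2 g); last first.
  by apply/funext => g; exact: densityE.
move=> g; apply: cvgM; last by have [_ + _ _] := Otheta; exact.
apply: (@continuous_comp _ _ _ (fun g => - (theta.1 (rho g v0) : R)) expR).
  by apply: cvgN; exact: rep_coef_continuous.
exact: continuous_expR.
Qed.

Lemma measurable_density :
  measurable_fun [set: borel_coset_space H]
    (fun x : borel_coset_space H => (density rho v0 theta x)%:E).
Proof.
apply/measurable_EFinP; apply: continuous_measurable_coset.
exact: density_continuous.
Qed.

Context (mu : {measure set (borel_coset_space H) -> \bar R}).

Lemma integral_density_scale (k : R) (A : set (borel_coset_space H)) :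
  0 <= k -> measurable A ->
  (\int[mu]_(x in A) (k * density rho v0 theta x)%:E =
   k%:E * p_tilde rho v0 mu theta A)%E.
Proof.
move=> k0 mA; under eq_integral do rewrite EFinM.
apply: ge0_integralZl_EFin => //.
  by move=> x _; rewrite lee_fin ltW// density_gt0.
exact: measurable_funTS measurable_density.
Qed.

Lemma p_tilde_ge0 A : (0 <= p_tilde rho v0 mu theta A)%E.
Proof. by apply: integral_ge0 => x _; rewrite lee_fin ltW// density_gt0. Qed.

Lemma p_tilde_le A : measurable A ->
  (p_tilde rho v0 mu theta A <= p_tilde rho v0 mu theta setT)%E.
Proof.
move=> mA; apply: ge0_subset_integral => //; first exact: measurable_density.
by move=> x _; rewrite lee_fin ltW// density_gt0.
Qed.

End Density.

(** The factor [chi] cancels the part [ln chi] of [xi] in the exponent. *)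
Lemma density_shift (theta : 'Hom(V, R^o) * (G -> R)) (xi : 'Hom(V, R^o))
    (chi : G -> R) (c : R) (x : X) :
  Omega0 H chi -> (forall g, xi (rho g v0) = ln (chi g) + c) ->
  density rho v0 (theta.1 + xi, fun g => theta.2 g * chi g) x =
  expR (- c) * density rho v0 theta x.
Proof.
move=> [chi0 _ _ _] xiE; rewrite /density/= add_lfunE xiE.
rewrite opprD opprD !expRD [expR (- ln _)]expRN lnK ?posrE//.
have := chi0 (repr x); move: (chi _) => t t0.
have tK : t^-1 * t = 1 by rewrite mulVf// gt_eqF.
by rewrite -[RHS]mulr1 -[X in _ = _ * X]tK; ring.
Qed.

(** The obstruction acts on parameters without changing the measures. *)
Lemma p_theta_shift (mu : {measure set (borel_coset_space H) -> \bar R})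
    (theta : 'Hom(V, R^o) * (G -> R)) (xi : 'Hom(V, R^o))
    (chi : G -> R) (c : R) :
  Theta rho v0 mu theta -> Omega0 H chi ->
  (forall g, xi (rho g v0) = ln (chi g) + c) ->
  let theta' := (theta.1 + xi, fun g => theta.2 g * chi g) in
  Theta rho v0 mu theta' /\
  forall A : set (borel_coset_space H), measurable A ->
    p_theta rho v0 mu theta' A = p_theta rho v0 mu theta A.
Proof.
move=> [Otheta Ttheta] Ochi xiE theta'.
have Otheta' : Omega0 H theta'.2 by exact: Omega0M.
have ptE A : measurable A -> p_tilde rho v0 mu theta' A =
    ((expR (- c))%:E * p_tilde rho v0 mu theta A)%E.
  move=> mA; rewrite -integral_density_scale ?expR_ge0//.
  by apply: eq_integral => x _; rewrite (density_shift _ _ Ochi xiE).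
have fT : p_tilde rho v0 mu theta setT \is a fin_num.
  by rewrite ge0_fin_numE// p_tilde_ge0.
split.
  by split => //; rewrite ptE// -(fineK fT) -EFinM ltry.
move=> A mA; rewrite /p_theta /phi (ptE A mA) (ptE setT measurableT).
apply: normalization_scale => //; first exact: expR_gt0.
  exact: p_tilde_ge0.
exact: p_tilde_le.
Qed.

(** Equal members of the family have equal normalized densities at every point, by
continuity; the constant [k] is the quotient of the normalizing factors. *)
Lemma p_theta_eq_inv (mu : {measure set (borel_coset_space H) -> \bar R})
    (theta theta' : 'Hom(V, R^o) * (G -> R)) :
  relatively_invariant mu ->
  Theta rho v0 mu theta -> Theta rho v0 mu theta' ->
  (forall A : set (borel_coset_space H), measurable A ->
    p_theta rho v0 mu theta A = p_theta rho v0 mu theta' A) ->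
  exists2 k : R, 0 < k & forall g,
    expR (- theta.1 (rho g v0)) * theta.2 g =
    k * (expR (- theta'.1 (rho g v0)) * theta'.2 g).
Proof.
move=> muinv [Ot Tt] [Ot' Tt'] peq.
pose q t (x : X) := expR (- phi rho v0 mu t) * density rho v0 t x.
have qc t : Omega0 H t.2 -> continuous (q t).
  by move=> O x; apply: (@cvgMl_tmp _ _ (nbhs x)); exact: density_continuous.
have qA t A : Omega0 H t.2 -> measurable A ->
    (\int[mu]_(x in A) (q t x)%:E = p_theta rho v0 mu t A)%E.
  by move=> O mA; rewrite integral_density_scale// expR_ge0.
have qq : q theta = q theta'.
  apply: (continuous_eq_of_integral_eq muinv); [exact: qc|exact: qc| |].
    apply/integrableP; split.
      by apply/measurable_EFinP;
        apply: continuous_measurable_coset; exact: qc.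
    under eq_integral => x _.
      rewrite /= ger0_norm; last first.
        by rewrite mulr_ge0 ?expR_ge0// ltW// density_gt0.
      over.
    rewrite qA// /p_theta; have fT : p_tilde rho v0 mu theta setT \is a fin_num.
      by rewrite ge0_fin_numE// p_tilde_ge0.
    by rewrite -(fineK fT) -EFinM ltry.
  move=> A mA; rewrite (qA theta A Ot mA) (qA theta' A Ot' mA).
  exact: peq A mA.
exists (expR (phi rho v0 mu theta - phi rho v0 mu theta')); first exact: expR_gt0.
move=> g; have := congr1 (fun f => f (\pi_X g)) qq.
rewrite /q !densityE// => qg.
by rewrite expRD -mulrA -qg mulrA -expRD subrr expR0 mul1r.
Qed.

(** The logarithm of the hypothesis exhibits the difference of the linear forms as
an obstruction with character [chi / chi'] and constant [- ln k]. *)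
Lemma theta_eq_of_proportional (theta theta' : 'Hom(V, R^o) * (G -> R)) (k : R) :
  ~ (exists (xi : 'Hom(V, R^o)) (chi : G -> R) (c : R),
        [/\ xi != 0, Omega0 H chi &
            forall g : G, xi (rho g v0) = ln (chi g) + c]) ->
  Omega0 H theta.2 -> Omega0 H theta'.2 -> 0 < k ->
  (forall g, expR (- theta.1 (rho g v0)) * theta.2 g =
             k * (expR (- theta'.1 (rho g v0)) * theta'.2 g)) ->
  theta = theta'.
Proof.
case: theta theta' => [xi chi] [xi' chi'] /= niii Ochi Ochi' k0 E.
have [chi0 _ _ _] := Ochi; have [chi0' _ _ _] := Ochi'.
have xiE : xi = xi'.
  apply/eqP; rewrite -subr_eq0; apply/negPn/negP => xi_neq; apply: niii.
  exists (xi - xi'), (fun g => chi g * (chi' g)^-1), (- ln k); split => //.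
    by apply: Omega0M => //; exact: Omega0V.
  move=> g; have /(congr1 (@ln R)) := E g.
  rewrite !lnM ?posrE ?mulr_gt0 ?invr_gt0 ?expR_gt0// !expRK lnV ?posrE//.
  by rewrite add_lfunE opp_lfunE => Eg; lra.
rewrite xiE in E *; congr pair.
(* At the identity both characters are [1] and the exponentials agree. *)
have k1 : k = 1.
  have /esym := E 1%g; rewrite !Omega0_1// !mulr1 -[RHS]mul1r => /mulIf; apply.
  by rewrite gt_eqF// expR_gt0.
apply/funext => g; have := E g; rewrite k1 mul1r => /mulfI; apply.
by rewrite gt_eqF// expR_gt0.
Qed.

End Family.
End CosetSpace.

(** * Equivalence of the three conditions *)

Theorem theorem1 (R : realType) (n : nat) (G : lieGroupType R n)
    (H : closed_subgroup G) (V : vectType R) (rho : representation G V)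
    (v0 : V) (mu : {measure set (borel_coset_space H) -> \bar R})
    (hv0 : rep_fixed H rho v0) (hmu : relatively_invariant mu)
    (hTheta : Theta rho v0 mu !=set0) :
  (p_theta_injective rho v0 mu <->
   ~ (exists xi : 'Hom(V, R^o), xi != 0 /\ log_Omega0 H (f_xi rho v0 xi))) /\
  (~ (exists xi : 'Hom(V, R^o), xi != 0 /\ log_Omega0 H (f_xi rho v0 xi)) <->
   ~ (exists (xi : 'Hom(V, R^o)) (chi : G -> R) (c : R),
        [/\ xi != 0, Omega0 H chi &
            forall g : G, xi (rho g v0) = ln (chi g) + c])).
Proof.
have ii_iii :
    (exists xi : 'Hom(V, R^o), xi != 0 /\ log_Omega0 H (f_xi rho v0 xi)) <->
    (exists (xi : 'Hom(V, R^o)) (chi : G -> R) (c : R),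
        [/\ xi != 0, Omega0 H chi &
            forall g : G, xi (rho g v0) = ln (chi g) + c]).
  split=> [[xi [xi0 /log_Omega0_f_xiP[chi [c [Ochi xiE]]]]]|].
    by exists xi, chi, c.
  move=> [xi [chi [c [xi0 Ochi xiE]]]]; exists xi; split => //.
  by apply/log_Omega0_f_xiP; exists chi, c.
split; last by rewrite ii_iii.
rewrite ii_iii; split=> [inj [xi [chi [c [xi0 Ochi xiE]]]]|niii].
  have [theta Ttheta] := hTheta.
  have [Ttheta' pE] := p_theta_shift hv0 Ttheta Ochi xiE.
  have /(congr1 fst)/= := inj _ _ Ttheta' Ttheta pE.
  by move/eqP; rewrite -subr_eq0 addrAC subrr add0r; exact/negP.
move=> theta theta' Ttheta Ttheta' pE.
have [k k0 kE] := p_theta_eq_inv hv0 hmu Ttheta Ttheta' pE.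
exact: (theta_eq_of_proportional niii Ttheta.1 Ttheta'.1 k0 kE).
Qed.
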